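(* Let $G$ be a locally nilpotent group that is not an abelian group of rank $\le 1$. Then the space $\mathrm{BiO}(G)$ of bi-invariant orders on $G$ has no isolated points.
   Context: A total order $\prec$ on the elements of a group $G$ is left-invariant if $x \prec y \Rightarrow gx \prec gy$ for all $x,y,g \in G$, and bi-invariant if moreover $x \prec y \Rightarrow xg \prec yg$ for all $x,y,g\in G$. $\mathrm{LO}(G)$ is the set of all left-invariant (strict total) orders on $G$, with the topology generated by the basic open sets $\{\, {\prec} \in \mathrm{LO}(G) \mid x \prec y \,\}$ for $x,y \in G$ (i.e. these sets form a subbasis). $\mathrm{BiO}(G)$ is the subset of bi-invariant orders, with the subspace topology. The rank of an abelian group $A$ is its torsion-free rank $\dim_{\mathbb{Q}}(A \otimes \mathbb{Q})$. A group is locally nilpotent if each of its finitely generated subgroups is nilpotent. *)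

(* Defs.v *)
From HB Require Import structures.
From mathcomp Require Import all_boot all_order all_algebra.
From mathcomp Require Import all_classical topology.

Set Implicit Arguments.
Unset Strict Implicit.
Unset Printing Implicit Defensive.

Local Open Scope classical_set_scope.
Local Open Scope group_scope.

Section LocallyNilpotent.
Variable G : groupType.
Implicit Types (A H : set G) (n : nat).

Definition is_subgroup H : Prop :=
  H 1 /\ forall x y, H x -> H y -> H (x / y).

Definition generated A : set G := smallest is_subgroup A.

Definition finitely_generated H : Prop :=
  exists s : seq G, H = generated [set` s].

Fixpoint lower_central_series H n : set G :=
  if n is n'.+1 then
    generated [set [~ x, y] | x in lower_central_series H n' & y in H]
  else H.

Definition nilpotent_subgroup H : Prop :=
  exists n, lower_central_series H n = [set 1].

Definition locally_nilpotent : Prop :=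
  forall H, is_subgroup H -> finitely_generated H -> nilpotent_subgroup H.

End LocallyNilpotent.

Arguments locally_nilpotent G : clear implicits.

Definition abelian_group (G : groupType) : Prop := forall x y : G, commute x y.

(* The tensor product of the multiplicatively written group G with Q over Z.  *)
(* The word [:: (x1, q1); ...; (xn, qn)] stands for the formal sum            *)
(* x1 (x) q1 + ... + xn (x) qn. Nothing below needs G to be abelian; without  *)
(* that hypothesis the construction yields the tensor product of the          *)
(* abelianization of G with Q.                                                *)
Section TensorQ.
Variable G : groupType.
Implicit Types (s t u : seq (G * rat)) (p q : rat) (x y : G).

(* The congruence generated by bilinearity. The rule tensq_eq0 is needed      *)
(* because words only form a monoid: it supplies the additive inverses.       *)
Inductive tensq_eq : seq (G * rat) -> seq (G * rat) -> Prop :=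
  | tensq_refl s : tensq_eq s s
  | tensq_sym s t : tensq_eq s t -> tensq_eq t s
  | tensq_trans s t u : tensq_eq s t -> tensq_eq t u -> tensq_eq s u
  | tensq_cat s s' t t' :
      tensq_eq s s' -> tensq_eq t t' -> tensq_eq (s ++ t) (s' ++ t')
  | tensq_catC s t : tensq_eq (s ++ t) (t ++ s)
  | tensq_eq0 x : tensq_eq [:: (x, 0%R)] [::]
  | tensq_mull x y q : tensq_eq [:: (x * y, q)] [:: (x, q); (y, q)]
  | tensq_addr x p q : tensq_eq [:: (x, (p + q)%R)] [:: (x, p); (x, q)].

Definition tensq_scale q s := [seq (z.1, (q * z.2)%R) | z <- s].

Lemma tensq_eq_scale q s t :
  tensq_eq s t -> tensq_eq (tensq_scale q s) (tensq_scale q t).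
Proof.
elim=> {s t} /=.
- by move=> s; exact: tensq_refl.
- by move=> s t _; exact: tensq_sym.
- by move=> s t u _ + _; exact: tensq_trans.
- by move=> s s' t t' _ ? _ ?; rewrite /tensq_scale !map_cat; exact: tensq_cat.
- by move=> s t; rewrite /tensq_scale !map_cat; exact: tensq_catC.
- by move=> x; rewrite GRing.mulr0; exact: tensq_eq0.
- by move=> x y p; exact: tensq_mull.
- by move=> x p r; rewrite GRing.mulrDr; exact: tensq_addr.
Qed.

Lemma tensq_scaleA p q s :
  tensq_scale p (tensq_scale q s) = tensq_scale (p * q)%R s.
Proof. by elim: s => //= -[x r] s ->; rewrite GRing.mulrA. Qed.

Lemma tensq_scale1 s : tensq_scale 1%R s = s.
Proof. by elim: s => //= -[x r] s ->; rewrite GRing.mul1r. Qed.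

Lemma tensq_scale0 s : tensq_eq (tensq_scale 0%R s) [::].
Proof.
elim: s => [|[x p] s IHs] /=; first exact: tensq_refl.
by rewrite GRing.mul0r; apply: (tensq_cat (tensq_eq0 x) IHs).
Qed.

Lemma tensq_scaleDl s p q :
  tensq_eq (tensq_scale (p + q)%R s) (tensq_scale p s ++ tensq_scale q s).
Proof.
elim: s => [|[x r] s IHs] /=; first exact: tensq_refl.
rewrite GRing.mulrDl.
apply: tensq_trans (tensq_cat (tensq_addr x _ _) IHs) _ => /=.
apply: (@tensq_cat [:: _] [:: _]); first exact: tensq_refl.
rewrite -cat_cons -[(_ :: tensq_scale q s)]cat1s catA.
by apply: tensq_cat (tensq_refl _); exact: (tensq_catC [:: _]).
Qed.

Definition tensq_eqb : rel (seq (G * rat)) := fun s t => `[< tensq_eq s t >].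

Lemma tensq_eqb_refl : reflexive tensq_eqb.
Proof. by move=> s; apply/asboolP/tensq_refl. Qed.

Lemma tensq_eqb_sym : symmetric tensq_eqb.
Proof.
by move=> s t; apply/asboolP/asboolP; apply: tensq_sym.
Qed.

Lemma tensq_eqb_trans : transitive tensq_eqb.
Proof.
by move=> s t u /asboolP ts /asboolP su; apply/asboolP/(tensq_trans ts su).
Qed.

Canonical tensq_eqb_equiv :=
  EquivRel tensq_eqb tensq_eqb_refl tensq_eqb_sym tensq_eqb_trans.

Local Open Scope quotient_scope.

Definition tensq : Type := {eq_quot tensq_eqb}.

HB.instance Definition _ := Choice.on tensq.
HB.instance Definition _ := EqQuotient.on tensq.

Lemma tensq_piP s t : \pi_tensq s = \pi_tensq t <-> tensq_eq s t.
Proof. by split=> [/eqquotP/asboolP//|st]; apply/eqquotP/asboolP. Qed.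

Lemma tensq_pi_repr s : tensq_eq (repr (\pi_tensq s)) s.
Proof. by apply/tensq_piP; rewrite reprK. Qed.

Definition tensq_zero : tensq := \pi_tensq [::].
Definition tensq_add (v w : tensq) : tensq := \pi_tensq (repr v ++ repr w).
Definition tensq_opp (v : tensq) : tensq := \pi_tensq (tensq_scale (-1)%R (repr v)).
Definition tensq_scaling q (v : tensq) : tensq := \pi_tensq (tensq_scale q (repr v)).

Lemma tensq_addE s t : tensq_add (\pi_tensq s) (\pi_tensq t) = \pi_tensq (s ++ t).
Proof. by apply/tensq_piP; apply: tensq_cat; exact: tensq_pi_repr. Qed.

Lemma tensq_scalingE q s :
  tensq_scaling q (\pi_tensq s) = \pi_tensq (tensq_scale q s).
Proof. by apply/tensq_piP/tensq_eq_scale/tensq_pi_repr. Qed.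

Lemma tensq_addA : associative tensq_add.
Proof.
elim/quotW=> s; elim/quotW=> t; elim/quotW=> u.
by rewrite (tensq_addE t u) (tensq_addE s t) [LHS]tensq_addE [RHS]tensq_addE catA.
Qed.

Lemma tensq_addC : commutative tensq_add.
Proof. by move=> v w; apply/tensq_piP/tensq_catC. Qed.

Lemma tensq_add0 : left_id tensq_zero tensq_add.
Proof. by move=> v; rewrite -[v]reprK tensq_addE. Qed.

Lemma tensq_addN : left_inverse tensq_zero tensq_opp tensq_add.
Proof.
move=> v; rewrite -{2}[v]reprK tensq_addE; apply/tensq_piP.
rewrite -{2}[repr v]tensq_scale1.
apply: tensq_trans (tensq_sym (tensq_scaleDl _ _ _)) _.
by rewrite GRing.addNr; exact: tensq_scale0.
Qed.

HB.instance Definition _ :=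
  GRing.isZmodule.Build tensq tensq_addA tensq_addC tensq_add0 tensq_addN.

Lemma tensq_scalingA p q (v : tensq) :
  tensq_scaling p (tensq_scaling q v) = tensq_scaling (p * q)%R v.
Proof.
elim/quotW: v => s; rewrite (tensq_scalingE q s).
by rewrite [LHS]tensq_scalingE [RHS]tensq_scalingE tensq_scaleA.
Qed.

Lemma tensq_scaling1 : left_id 1%R tensq_scaling.
Proof. by elim/quotW=> s; rewrite tensq_scalingE tensq_scale1. Qed.

Lemma tensq_scalingDr : right_distributive tensq_scaling (@GRing.add tensq).
Proof.
move=> q; elim/quotW=> s; elim/quotW=> t.
rewrite (tensq_scalingE q s) (tensq_scalingE q t) [RHS]tensq_addE.
rewrite [X in tensq_scaling q X]tensq_addE [LHS]tensq_scalingE.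
by rewrite /tensq_scale map_cat.
Qed.

Lemma tensq_scalingDl (v : tensq) :
  {morph tensq_scaling^~ v : p q / (p + q)%R}.
Proof.
elim/quotW: v => s p q /=.
rewrite (tensq_scalingE p s) (tensq_scalingE q s) (tensq_scalingE (p + q)%R s).
rewrite [RHS]tensq_addE.
exact/tensq_piP/tensq_scaleDl.
Qed.

HB.instance Definition _ := GRing.Zmodule_isLmodule.Build rat tensq
  tensq_scalingA tensq_scaling1 tensq_scalingDr tensq_scalingDl.

Definition tens x q : tensq := \pi_tensq [:: (x, q)].

Lemma tens_mull x y q : tens (x * y) q = (tens x q + tens y q)%R.
Proof.
rewrite /tens [RHS]tensq_addE.
by apply/tensq_piP/tensq_mull.
Qed.

Lemma tens_addr x p q : tens x (p + q)%R = (tens x p + tens x q)%R.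
Proof.
rewrite /tens [RHS]tensq_addE.
by apply/tensq_piP/tensq_addr.
Qed.

Lemma tens_scale x p q : (p *: tens x q)%R = tens x (p * q)%R.
Proof. by rewrite /tens [LHS]tensq_scalingE. Qed.

Lemma tensq_sum (v : tensq) : exists s, v = (\sum_(z <- s) tens z.1 z.2)%R.
Proof.
exists (repr v); rewrite -[LHS]reprK.
elim: (repr v) => [|[x q] s IHs]; first by rewrite big_nil.
by rewrite big_cons -IHs [RHS]tensq_addE.
Qed.

Lemma tensq_universal (V : zmodType) (f : G -> rat -> V) :
    (forall x y q, f (x * y) q = (f x q + f y q)%R) ->
    (forall x p q, f x (p + q)%R = (f x p + f x q)%R) ->
  exists h : {additive tensq -> V}, (forall x q, h (tens x q) = f x q) /\
    forall k : {additive tensq -> V},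
      (forall x q, k (tens x q) = f x q) -> k =1 h.
Proof.
move=> fl fr.
pose F s : V := (\sum_(z <- s) f z.1 z.2)%R.
have f0 x : f x 0%R = 0%R.
  by apply: (@GRing.addrI _ (f x 0%R)); rewrite -fr !GRing.addr0.
have Feq s t : tensq_eq s t -> F s = F t.
  elim=> {s t} //=; rewrite /F.
  - by move=> s t u _ -> _ ->.
  - by move=> s s' t t' _ es _ et; rewrite !big_cat /= es et.
  - by move=> s t; rewrite !big_cat /= GRing.addrC.
  - by move=> x; rewrite big_seq1 big_nil f0.
  - by move=> x y q; rewrite !big_cons !big_nil !GRing.addr0 fl.
  - by move=> x p q; rewrite !big_cons !big_nil !GRing.addr0 fr.
pose h (v : tensq) := F (repr v).
have hE s : h (\pi_tensq s) = F s by apply: Feq; exact: tensq_pi_repr.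
have hD : GRing.nmod_morphism h.
  split; first by rewrite [h _]hE /F big_nil.
  move=> v w; rewrite -[v]reprK -[w]reprK.
  by rewrite [(_ + _)%R]tensq_addE !hE /F big_cat.
pose hA := GRing.isNmodMorphism.Build _ _ h hD.
pose H : {additive tensq -> V} := HB.pack h hA.
exists H; split.
  by move=> x q; rewrite [LHS]hE /F big_seq1.
move=> k kE v; have [s ->] := tensq_sum v.
rewrite !GRing.raddf_sum; apply: eq_bigr => z _.
by rewrite kE [RHS]hE /F big_seq1.
Qed.

End TensorQ.

Arguments tensq G : clear implicits.

Section Rank.

Definition is_basis (V : lmodType rat) (n : nat) (b : 'I_n -> V) : Prop :=
  forall v : V, exists! c : {ffun 'I_n -> rat}, v = (\sum_i c i *: b i)%R.

Definition has_dim (V : lmodType rat) (n : nat) : Prop :=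
  exists b : 'I_n -> V, is_basis b.

(* For abelian G: the torsion-free rank of G is at most n.                    *)
Definition rank_le (G : groupType) (n : nat) : Prop :=
  exists2 r : nat, (r <= n)%N & has_dim (tensq G) r.

End Rank.

Record left_order (G : groupType) := LeftOrder {
  lo_rel :> rel G;
  lo_irr : irreflexive lo_rel;
  lo_trans : transitive lo_rel;
  lo_total : forall x y, [|| lo_rel x y, x == y | lo_rel y x];
  lo_left : forall g x y, lo_rel x y -> lo_rel (g * x) (g * y)
}.

HB.instance Definition _ (G : groupType) := gen_eqMixin (left_order G).
HB.instance Definition _ (G : groupType) := gen_choiceMixin (left_order G).

Definition lo_subbase (G : groupType) : set (set (left_order G)) :=
  [set U | exists x y : G, U = [set o : left_order G | o x y]].

HB.instance Definition _ (G : groupType) :=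
  isSubBaseTopological.Build (left_order G) (@lo_subbase G) id.

Definition BiO (G : groupType) : set (left_order G) :=
  [set o : left_order G | forall g x y : G, o x y -> o (x * g) (y * g)].

Arguments BiO G : clear implicits.

(* Main.v *)
Require Import Defs.
From mathcomp Require Import all_boot all_order all_algebra.
From mathcomp Require Import all_classical topology.
From mathcomp Require Import finmap reals Rstruct zify lra.

(** Suppose that a bi-invariant order on [G] is isolated. By definition there are
    then finitely many positive elements [gs] such that it is the only
    bi-invariant order making them positive. The proof shows that [G] is abelian
    of rank at most 1, by constructing other orders from homomorphisms to the
    reals.

    For a positive [t], the convex subgroup [hull t] carries an essentially unique
    order-preserving homomorphism [holder t] to the reals (Hölder's theorem).
    Uniqueness implies that conjugation by any [y] rescales it, and local
    nilpotency forces the factor to be 1, because the iterated commutators with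
    [y] die out: the convex subgroups are normal and their archimedean layers are
    central ([hull_conj], [holder_conj]).

    Now let [D] be a convex normal subgroup and [f] a conjugation-invariant
    homomorphism from [D] to the reals. Deciding signs in [D] by [f], with the old
    order breaking ties, gives another bi-invariant order ([reordering]). Isolation
    therefore says that [f] is nonnegative on the positive elements of [D] as soon
    as it is so on [gs] ([isolated_hom_ge0]). This is used twice.

    With [f := - holder t] it reverses one archimedean layer, so every layer
    contains an element of [gs] ([isolating_archimedean]). In particular there are
    finitely many layers and the largest element [a] of [gs] has [hull a = G].

    With [D := G] and [f := holder a + e g] for small [e > 0] it shows that there is
    no homomorphism [g] that is nonnegative on the elements of [gs] killed by
    [holder a] and is transverse to [holder a] ([isolating_no_transverse_hom]). If
    [holder a] had an irrational value, composing it with a suitable additive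
    function of the reals would give such a [g]. If it has only rational values
    but a nontrivial kernel, with largest element [h] of [gs] in it, then [holder h]
    extends from the kernel to such a [g]. Hence [holder a] embeds [G] into the
    rationals. *)

Set Implicit Arguments.
Unset Strict Implicit.
Unset Printing Implicit Defensive.

Import Order.TTheory GRing.Theory Num.Theory.

Local Open Scope classical_set_scope.
Local Open Scope ring_scope.
Local Open Scope group_scope.

(** * Integer powers, subgroups and homomorphisms *)

Section IntegerPowers.
Variable G : groupType.
Implicit Types (x y : G) (k l : int).

Definition zexp x k : G :=
  match k with Posz n => x ^+ n | Negz n => x ^- n.+1 end.

Lemma zexp1r x : zexp x 1 = x.
Proof. by rewrite /zexp /= expg1. Qed.

Lemma zexpSr x k : zexp x (k + 1)%R = zexp x k * x.
Proof.
case: k => n.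
  by rewrite (_ : (Posz n + 1)%R = Posz n.+1) /=; [exact: expgSr | lia].
case: n => [|n]; first by rewrite /= expg1 mulVg.
rewrite (_ : (Negz n.+1 + 1)%R = Negz n) /=; last by rewrite !NegzE; lia.
by rewrite (expgS x n.+1) invgM mulgVK.
Qed.

Lemma zexpD x k l : zexp x (k + l)%R = zexp x k * zexp x l.
Proof.
elim/int_rect: l => [|l IHl|l IHl]; first by rewrite addr0 mulg1.
  by rewrite intS [(1 + _)%R]addrC addrA !zexpSr IHl mulgA.
apply: (@mulIg _ x); rewrite -mulgA -!zexpSr -addrA.
by rewrite (_ : (- l.+1%:Z + 1 = - l%:Z)%R) //; lia.
Qed.

Lemma zexpN x k : zexp x (- k)%R = (zexp x k)^-1.
Proof. by apply: (@mulIg _ (zexp x k)); rewrite -zexpD addNr mulVg. Qed.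

Lemma zexpM x k n : zexp x (k * n%:Z)%R = zexp x k ^+ n.
Proof.
elim: n => [|n IHn]; first by rewrite mulr0.
by rewrite intS mulrDr mulr1 zexpD IHn expgS.
Qed.

End IntegerPowers.

Section Subgroups.
Variables (G : groupType) (D : set G).
Hypothesis D_sub : is_subgroup D.
Implicit Types (x y : G) (n : nat) (k : int).

Lemma subgroup1 : D 1. Proof. exact: D_sub.1. Qed.

Lemma subgroupV x : D x -> D x^-1.
Proof. by move=> Dx; rewrite -div1g; apply: D_sub.2 => //; exact: D_sub.1. Qed.

Lemma subgroupM x y : D x -> D y -> D (x * y).
Proof.
by move=> Dx Dy; rewrite -[y]invgK; apply: D_sub.2 => //; exact: subgroupV.
Qed.

Lemma subgroupX x n : D x -> D (x ^+ n).
Proof.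
move=> Dx; elim: n => [|n IHn]; first exact: subgroup1.
by rewrite expgS; apply: subgroupM.
Qed.

Lemma subgroup_zexp x k : D x -> D (zexp x k).
Proof.
by move=> Dx; case: k => n /=; [|apply: subgroupV]; exact: subgroupX.
Qed.

Variables (A : zmodType) (f : G -> A).
Hypothesis fM : forall x y, D x -> D y -> f (x * y) = (f x + f y)%R.

Lemma hom_on1 : f 1 = 0%R.
Proof.
by apply: (addrI (f 1)); rewrite -fM ?mulg1 ?addr0 //; exact: subgroup1.
Qed.

Lemma hom_onV x : D x -> f x^-1 = (- f x)%R.
Proof.
move=> Dx; apply/eqP; rewrite -addr_eq0 -fM ?mulVg ?hom_on1 //.
exact: subgroupV.
Qed.

Lemma hom_onX x n : D x -> f (x ^+ n) = (f x *+ n)%R.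
Proof.
move=> Dx; elim: n => [|n IHn]; first exact: hom_on1.
by rewrite expgS mulrS fM ?IHn //; exact: subgroupX.
Qed.

Lemma hom_on_zexp x k : D x -> f (zexp x k) = (f x *~ k)%R.
Proof.
move=> Dx; case: k => n /=; first by rewrite hom_onX.
by rewrite hom_onV ?hom_onX //; exact: subgroupX.
Qed.

End Subgroups.

Lemma setT_subgroup (G : groupType) : is_subgroup [set: G].
Proof. by []. Qed.

(** In a bi-ordered group the powers of a product are controlled without any
    commutativity: if [x y <= y x], moving the letters [x] to the left in
    [(x y)^n] decreases it and moving them to the right increases it. The
    relation is abstract so that the case [y x <= x y] is the same statement for
    the opposite order. *)
Lemma expgM_squeeze (G : groupType) (r : G -> G -> Prop) (x y : G) n :
    (forall u, r u u) -> (forall v u w, r u v -> r v w -> r u w) ->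
    (forall u v w z, r u v -> r w z -> r (u * w) (v * z)) ->
  r (x * y) (y * x) ->
  r (x ^+ n * y ^+ n) ((x * y) ^+ n) /\ r ((x * y) ^+ n) (y ^+ n * x ^+ n).
Proof.
move=> r_refl r_trans r_mul xy.
have xyn k : r (x * y ^+ k) (y ^+ k * x).
  elim: k => [|k IHk]; first by rewrite mulg1 mul1g.
  rewrite expgSr mulgA; apply: (r_trans (y ^+ k * x * y)); first exact: r_mul.
  by rewrite -!mulgA; apply: r_mul.
have xny k : r (x ^+ k * y) (y * x ^+ k).
  elim: k => [|k IHk]; first by rewrite mulg1 mul1g.
  rewrite expgS -mulgA; apply: (r_trans (x * (y * x ^+ k))); first exact: r_mul.
  by rewrite !mulgA; apply: r_mul.
elim: n => [|n [IH1 IH2]]; first by rewrite mulg1.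
split.
  rewrite !expgSr; apply: (r_trans (x ^+ n * y ^+ n * (x * y))); last exact: r_mul.
  have -> : x ^+ n * x * (y ^+ n * y) = x ^+ n * (x * y ^+ n) * y by rewrite !mulgA.
  have -> : x ^+ n * y ^+ n * (x * y) = x ^+ n * (y ^+ n * x) * y by rewrite !mulgA.
  by apply: (r_mul); first exact: r_mul.
rewrite [X in r X]expgSr; apply: (r_trans (y ^+ n * x ^+ n * (x * y))); first exact: r_mul.
have -> : y ^+ n * x ^+ n * (x * y) = y ^+ n * (x ^+ n.+1 * y).
  by rewrite expgSr !mulgA.
by rewrite (expgSr y) -mulgA; apply: r_mul.
Qed.

(** * Bi-ordered groups *)

Section BiOrderedGroup.
Variables (G : groupType) (o : left_order G).
Hypothesis o_bi : BiO G o.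
Implicit Types (x y z t : G) (n : nat) (p : int).

Local Notation "x ≺ y" := (o x y) (at level 70).
Local Notation "x ≼ y" := (~~ o y x) (at level 70).

Lemma ole_refl x : x ≼ x.
Proof. by rewrite lo_irr. Qed.

Lemma oltW x y : x ≺ y -> x ≼ y.
Proof. by move=> xy; apply/negP=> /(lo_trans xy); rewrite lo_irr. Qed.

Lemma ole_lt_eq x y : x ≼ y -> x = y \/ x ≺ y.
Proof. by have /or3P[->|/eqP|->] := lo_total o x y; [right|left|]. Qed.

Lemma ole_trans y x z : x ≼ y -> y ≼ z -> x ≼ z.
Proof.
move=> /ole_lt_eq[->//|xy] /ole_lt_eq[<-|yz]; apply: oltW => //.
exact: lo_trans yz.
Qed.

Lemma olt_mul2l z x y : (z * x ≺ z * y) = (x ≺ y).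
Proof.
apply/idP/idP => [h|]; last exact: lo_left.
by rewrite -(mulKg z x) -(mulKg z y); apply: lo_left.
Qed.

Lemma olt_mul2r z x y : (x * z ≺ y * z) = (x ≺ y).
Proof.
apply/idP/idP => [h|]; last exact: o_bi.
by rewrite -(mulgK z x) -(mulgK z y); apply: o_bi.
Qed.

Lemma ole_mul x y z t : x ≼ y -> z ≼ t -> x * z ≼ y * t.
Proof.
move=> xy zt; apply: (@ole_trans (y * z)); first by rewrite olt_mul2r.
by rewrite olt_mul2l.
Qed.

Lemma olt_inv x y : (x^-1 ≺ y^-1) = (y ≺ x).
Proof. by rewrite -(olt_mul2l x) -(olt_mul2r y) mulgV mul1g mulgVK. Qed.

Lemma olt_conj z x y : (x ^ z ≺ y ^ z) = (x ≺ y).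
Proof. by rewrite /conjg olt_mul2l olt_mul2r. Qed.

Lemma olt_1inv x : (1 ≺ x^-1) = (x ≺ 1).
Proof. by rewrite -[1 in LHS]invg1 olt_inv. Qed.

Lemma olt_divl x y : (1 ≺ x^-1 * y) = (x ≺ y).
Proof. by rewrite -(olt_mul2l x) mulg1 mulVKg. Qed.

Lemma ole_exp x y n : x ≼ y -> x ^+ n ≼ y ^+ n.
Proof.
move=> xy; elim: n => [|n IHn]; first exact: ole_refl.
by rewrite !expgS; apply: ole_mul.
Qed.

Lemma ole_exp1 x n : 1 ≼ x -> 1 ≼ x ^+ n.
Proof. by move=> /(ole_exp n); rewrite expg1n. Qed.

Lemma zexp_mono g p q : 1 ≼ g -> (p <= q)%R -> zexp g p ≼ zexp g q.
Proof.
move=> g1 pq; rewrite -(subrK p q).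
have /gez0_abs <- : (0 <= q - p)%R by rewrite subr_ge0.
rewrite addrC zexpD -[X in X ≼ _]mulg1 olt_mul2l.
exact: ole_exp1.
Qed.

Lemma zexp_le g p q : 1 ≺ g -> zexp g p ≼ zexp g q -> (p <= q)%R.
Proof.
move=> g1 gpq; rewrite leNgt; apply/negP => qp.
have : zexp g (q + 1)%R ≼ zexp g p.
  by apply: zexp_mono; [exact: oltW | rewrite lezD1].
move=> /ole_trans/(_ gpq); rewrite zexpSr -[X in _ ≼ X]mulg1 olt_mul2l.
by rewrite g1.
Qed.

Lemma expgM_between x y n :
  (x ^+ n * y ^+ n ≼ (x * y) ^+ n /\ (x * y) ^+ n ≼ y ^+ n * x ^+ n) \/
  (y ^+ n * x ^+ n ≼ (x * y) ^+ n /\ (x * y) ^+ n ≼ x ^+ n * y ^+ n).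
Proof.
have [/oltW xy|yx] := boolP (x * y ≺ y * x); [left | right].
  by apply: (@expgM_squeeze _ (fun u v => u ≼ v)) => //;
    [exact: ole_refl | move=> ? ? ?; exact: ole_trans | exact: ole_mul].
have [] := @expgM_squeeze _ (fun u v => v ≼ u) x y n.
- exact: ole_refl.
- by move=> v u w uv vw; apply: ole_trans uv.
- by move=> u v w z uv wz; apply: ole_mul.
- by [].
by split.
Qed.

End BiOrderedGroup.

(** * Convex hulls and Hölder homomorphisms *)

Section Archimedean.
Variable R : realType.

Lemma archi_eq (a b c : R) :
  (forall n, (`|a - b| * n%:R <= c)%R) -> a = b.
Proof.
move=> h; apply/eqP; rewrite -subr_eq0 -normr_le0 leNgt; apply/negP => ab0.
have := h (Num.bound (c / `|a - b|)); rewrite leNgt => /negP; apply.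
rewrite mulrC -ltr_pdivrMr //; apply: archi_boundP.
by rewrite divr_ge0 // -(mulr0 `|a - b|%R); apply: h 0.
Qed.

End Archimedean.

Section Hulls.
Variables (G : groupType) (o : left_order G).
Hypothesis o_bi : BiO G o.
Implicit Types (x y z t : G) (n : nat) (p : int).

Local Notation "x ≺ y" := (o x y) (at level 70).
Local Notation "x ≼ y" := (~~ o y x) (at level 70).

(** For [1 ≺ t] this is the convex subgroup generated by [t]: the elements that are
    not infinitely larger than [t]. *)
Definition hull t : set G :=
  [set x | exists k : nat, x ≼ t ^+ k /\ x^-1 ≼ t ^+ k].

Lemma hullV t x : hull t x -> hull t x^-1.
Proof. by move=> [k [? ?]]; exists k; rewrite invgK. Qed.

Lemma hull_pos t x n : 1 ≺ t -> 1 ≼ x -> x ≼ t ^+ n -> hull t x.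
Proof.
move=> t1 x1 xn; exists n; split => //.
apply: (@ole_trans _ _ 1); last by apply: ole_exp1 => //; apply: oltW.
by rewrite olt_1inv.
Qed.

Lemma hull_gen t : 1 ≺ t -> hull t t.
Proof.
by move=> t1; apply: (@hull_pos _ _ 1) => //; [exact: oltW | rewrite expg1 ole_refl].
Qed.

Lemma hull1 t : hull t 1.
Proof. by exists 0; rewrite invg1 ole_refl. Qed.

Lemma hullM t x y : hull t x -> hull t y -> hull t (x * y).
Proof.
move=> [k [xk Xk]] [l [yl Yl]]; exists (k + l)%N; split.
  by rewrite expgnDr ole_mul.
by rewrite addnC expgnDr invgM ole_mul.
Qed.

Lemma hull_subgroup t : is_subgroup (hull t).
Proof.
by split=> [|x y tx /hullV ty]; [exact: hull1 | exact: hullM].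
Qed.

Lemma hull_convex t x y : 1 ≺ t -> hull t y -> 1 ≼ x -> x ≼ y -> hull t x.
Proof.
move=> t1 [k [yk _]] x1 xy; apply: (@hull_pos _ _ k) => //.
exact: ole_trans yk.
Qed.

Lemma hull_floor t x : 1 ≺ t -> hull t x ->
  exists p, zexp t p ≼ x /\ x ≼ zexp t (p + 1)%R.
Proof.
move=> t1 [k [xk Xk]].
pose P n := zexp t (n%:Z - k%:Z)%R ≼ x.
have P0 : exists n, P n.
  by exists 0; rewrite /P sub0r zexpN -olt_inv // invgK.
have Pb n : P n -> (n <= k + k)%N.
  move=> /ole_trans/(_ xk) h.
  by have := @zexp_le _ _ o_bi _ _ k%:Z t1 h; lia.
exists ((ex_maxn P0 Pb)%:Z - k%:Z)%R.
case: ex_maxnP => n Pn nmax; split => //.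
apply/negP => h; have /nmax : P n.+1.
  by rewrite /P (_ : (_ - _)%R = (n%:Z - k%:Z + 1)%R) ?oltW //; lia.
by rewrite ltnn.
Qed.

Section Holder.
Variable R : realType.

(** Hölder's homomorphism of the archimedean top layer of [hull t], normalised to
    take the value 1 at [t]: the Dedekind cut of the fractions [p / n] with
    [t^p <= x^n]. It is meaningful on [hull t]; its kernel there consists of the
    elements infinitely smaller than [t]. *)
Definition holder t x : R :=
  sup [set r | exists n p,
    [/\ (0 < n)%N, zexp t p ≼ x ^+ n & r = (p%:~R / n%:R)%R]].

Variable t : G.
Hypothesis t1 : 1 ≺ t.

(** The fractions below the cut lie under those above it: raise both inequalities to
    a common exponent of [x]. *)
Let frac_le n m p q x : (0 < n)%N -> (0 < m)%N ->
  zexp t p ≼ x ^+ n -> x ^+ m ≼ zexp t q ->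
  (p%:~R / n%:R <= q%:~R / m%:R :> R)%R.
Proof.
move=> n0 m0 px xq.
rewrite ler_pdivrMr ?ltr0n // mulrAC ler_pdivlMr ?ltr0n //.
rewrite !pmulrn -!(intrM R) ler_int.
apply: (zexp_le o_bi t1); rewrite !zexpM.
apply: (@ole_trans _ _ (x ^+ n ^+ m)); first exact: ole_exp.
by rewrite expgnAC; apply: ole_exp.
Qed.

Lemma holder_ub n p x : hull t x -> (0 < n)%N -> x ^+ n ≼ zexp t p ->
  (holder t x <= p%:~R / n%:R)%R.
Proof.
move=> tx n0 xp; apply: ge_sup.
  have [q [qx _]] := hull_floor t1 tx.
  by exists (q%:~R / 1%:R)%R, 1%N, q.
by move=> _ [m [q [m0 qx ->]]]; exact: frac_le xp.
Qed.

Lemma holder_lb n p x : hull t x -> (0 < n)%N -> zexp t p ≼ x ^+ n ->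
  (p%:~R / n%:R <= holder t x)%R.
Proof.
move=> tx n0 px; apply: ub_le_sup; last by exists n, p.
have [q [_ xq]] := hull_floor t1 tx.
exists ((q + 1)%:~R / 1%:R)%R => _ [m [r [m0 rx ->]]].
exact: (@frac_le _ 1%N _ _ x m0 isT rx xq).
Qed.

(** The integer [p] is a floor of [n * holder t x] read off from the order alone,
    which gives every estimate below up to an error bounded independently of [n]. *)
Lemma holder_approx x n : hull t x -> exists p,
  [/\ zexp t p ≼ x ^+ n, x ^+ n ≼ zexp t (p + 1)%R &
      (p%:~R <= n%:R * holder t x <= p%:~R + 1)%R].
Proof.
move=> tx; case: n => [|n].
  exists 0%R; rewrite !mul0r lexx !add0r ler01 ole_refl zexp1r; split=> //.
  exact: oltW.
have [p [px xp]] := hull_floor t1 (subgroupX (hull_subgroup t) n.+1 tx).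
exists p; split => //.
have := holder_lb tx (ltn0Sn n) px; rewrite ler_pdivrMr ?ltr0n // mulrC => ->.
have := holder_ub tx (ltn0Sn n) xp; rewrite ler_pdivlMr ?ltr0n // mulrC.
by rewrite intrD.
Qed.

(** [(x y)^n] lies between [x^n y^n] and [y^n x^n], and both are trapped between
    the same powers of [t]; so the defect of additivity is at most [4 / n] for
    all [n]. *)
Lemma holderM x y : hull t x -> hull t y ->
  holder t (x * y) = (holder t x + holder t y)%R.
Proof.
move=> tx ty; apply: (@archi_eq _ _ _ 4) => n.
have [p [px xp hx]] := holder_approx n tx.
have [q [qy yq hy]] := holder_approx n ty.
have [r [rxy xyr hxy]] := holder_approx n (hullM tx ty).
have [pq_xy xy_pq] : zexp t (p + q)%R ≼ (x * y) ^+ n /\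
    (x * y) ^+ n ≼ zexp t (p + 1 + (q + 1))%R.
  have [[h1 h2]|[h1 h2]] := expgM_between o_bi x y n.
    split; first by apply: ole_trans h1; rewrite zexpD; apply: ole_mul.
    by apply: ole_trans h2 _; rewrite addrC zexpD; apply: ole_mul.
  split; first by apply: ole_trans h1; rewrite addrC zexpD; apply: ole_mul.
  by apply: ole_trans h2 _; rewrite zexpD; apply: ole_mul.
have h1 := zexp_le o_bi t1 (ole_trans pq_xy xyr).
have h2 := zexp_le o_bi t1 (ole_trans rxy xy_pq).
move: h1 h2; rewrite -!(ler_int R) !intrD => h1 h2.
rewrite -[X in (_ * X)%R](ger0_norm (ler0n R n)) -normrM mulrC.
rewrite ler_norml; apply/andP; split; lra.
Qed.

Lemma holder_ge0 x : hull t x -> 1 ≼ x -> (0 <= holder t x)%R.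
Proof. by move=> tx x1; have := @holder_lb 1%N 0%R x tx isT x1; rewrite mul0r. Qed.

(** An order-preserving homomorphism [f] is sandwiched by the same powers of [t]:
    [p f(t) <= n f(x) <= (p + 1) f(t)] whenever [t^p <= x^n <= t^(p+1)]. *)
Lemma holder_uniq (f : G -> R) x :
    (forall x y, hull t x -> hull t y -> f (x * y) = (f x + f y)%R) ->
    (forall x, hull t x -> 1 ≼ x -> (0 <= f x)%R) ->
  hull t x -> f x = (f t * holder t x)%R.
Proof.
move=> fM f_ge0 tx; have ht := hull_gen t1; have D := hull_subgroup t.
have f_le y z : hull t y -> hull t z -> y ≼ z -> (f y <= f z)%R.
  move=> ty tz yz; rewrite -subr_ge0 addrC -(hom_onV D fM) // -fM //.
    apply: f_ge0; first by apply: hullM => //; exact: hullV.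
    by rewrite -(olt_mul2l o y) mulVKg mulg1.
  exact: hullV.
apply: (@archi_eq _ _ _ (f t)) => n.
have [p [px xp /andP[hp ph]]] := holder_approx n tx.
have tz k := subgroup_zexp D k ht; have tX := subgroupX D n tx.
have := f_le _ _ (tz _) tX px; have := f_le _ _ tX (tz _) xp.
have ft := f_ge0 _ ht (oltW t1).
have fz k : f (zexp t k) = (k%:~R * f t)%R.
  by rewrite (hom_on_zexp D fM) // mulrzl.
rewrite (hom_onX D fM) // -[(f x *+ n)%R]mulr_natl !fz intrD => h1 h2.
have := ler_wpM2l ft hp; have := ler_wpM2l ft ph => h3 h4.
rewrite -[X in (_ * X)%R](ger0_norm (ler0n R n)) -normrM mulrC.
rewrite ler_norml; apply/andP; split; lra.
Qed.

Lemma holder_le x y : hull t x -> hull t y -> x ≼ y ->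
  (holder t x <= holder t y)%R.
Proof.
move=> tx ty xy; have tV := hullV tx.
rewrite -subr_ge0 addrC -(hom_onV (hull_subgroup t) holderM) // -holderM //.
apply: holder_ge0; first exact: hullM.
by rewrite -(olt_mul2l o x) mulVKg mulg1.
Qed.

Lemma holder_gen : holder t t = 1%R.
Proof.
apply/eqP; rewrite eq_le.
have := @holder_lb 1%N 1%R t (hull_gen t1) isT; rewrite zexp1r expg1 divr1 ole_refl.
move=> ->//.
have := @holder_ub 1%N 1%R t (hull_gen t1) isT; rewrite zexp1r expg1 divr1 ole_refl.
by move=> ->.
Qed.

End Holder.
End Hulls.

(** * Conjugation in a locally nilpotent group *)

Lemma iter_commg_eq1 (G : groupType) (x y : G) : locally_nilpotent G ->
  exists n, iter n (fun z => [~ z, y]) x = 1.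
Proof.
move=> G_nil; pose H := generated [set` [:: x; y]].
have [gx gy] : H x /\ H y.
  by split=> K [_ sK]; apply: sK; rewrite /= !inE eqxx ?orbT.
have gH : is_subgroup H.
  split; first by move=> K [[]].
  move=> u v hu hv K KH; have [[_ KV] _] := KH.
  by apply: KV; [exact: hu | exact: hv].
have [n Hn] := G_nil H gH (ex_intro _ [:: x; y] erefl).
exists n; suff : lower_central_series H n (iter n (fun z => [~ z, y]) x).
  by rewrite Hn.
elim: n {Hn} => [|n IHn] //= K [_ sK]; apply: sK.
by exists (iter n (fun z => [~ z, y]) x) => //; exists y.
Qed.

Section ConjugationInvariance.
Variables (G : groupType) (o : left_order G).
Hypothesis o_bi : BiO G o.
Hypothesis G_nil : locally_nilpotent G.
Variable R : realType.
Implicit Types (x y z t : G) (n : nat) (p : int).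

Local Notation "x ≺ y" := (o x y) (at level 70).
Local Notation "x ≼ y" := (~~ o y x) (at level 70).
Local Notation hull := (hull o).
Local Notation holder := (holder o R).

Let hull_conj_of t y z : 1 ≺ t -> hull t (t ^ y) -> hull t z -> hull t (z ^ y).
Proof.
move=> t1 [m [tm _]] [k [zk Zk]]; exists (m * k)%N.
rewrite expgnA -conjVg; split.
  by apply: ole_trans (ole_exp o_bi k tm); rewrite -conjXg olt_conj.
by apply: ole_trans (ole_exp o_bi k tm); rewrite -conjXg olt_conj.
Qed.

(** Conjugation by [y] multiplies the Hölder homomorphism by a constant [c], since
    the conjugate is again monotone. Hence the iterated commutators
    [[t, y, ..., y]] take the values [(c - 1)^n]; they are eventually trivial, so
    [c = 1]. *)
Let holder_conj_gen t y : 1 ≺ t -> hull t (t ^ y) -> holder t (t ^ y) = 1%R.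
Proof.
move=> t1 tty; set c := holder t (t ^ y).
have tJ z : hull t z -> hull t (z ^ y) by exact: hull_conj_of.
have cE z : hull t z -> holder t (z ^ y) = (c * holder t z)%R.
  apply: (holder_uniq o_bi t1 (f := fun z => holder t (z ^ y))) => {}z.
    by move=> u tz tu; rewrite conjMg (holderM o_bi) //; exact: tJ.
  by move=> tz z1; apply: (holder_ge0 o_bi) (tJ _ tz) _; rewrite // -(conj1g y) olt_conj.
have D := hull_subgroup o_bi t; have hM := holderM o_bi R t1.
pose u n := iter n (fun z => [~ z, y]) t.
have uE n : hull t (u n) /\ holder t (u n) = ((c - 1) ^+ n)%R.
  elim: n => [|n [tu hu]].
    by split; [exact: hull_gen | exact: holder_gen].
  have tV := hullV tu; rewrite /= /commg; split.
    by apply: hullM => //; exact: tJ.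
  rewrite (holderM o_bi) // ?(hom_onV D hM) // ?cE //; last exact: tJ.
  by rewrite hu exprS; lra.
have [n un1] := iter_commg_eq1 t y G_nil.
have [_] := uE n; rewrite /u un1 (hom_on1 D hM) => /esym/eqP.
by rewrite expf_eq0 => /andP[_]; rewrite subr_eq0 => /eqP.
Qed.

(** If [s := t^y] were infinitely larger than [t], then [t = s^(y^-1)] would lie in
    [hull s] and have Hölder value 1 relative to [s] by the previous lemma, while
    being infinitely smaller than [s]. *)
Lemma hull_conj t y z : 1 ≺ t -> hull t z -> hull t (z ^ y).
Proof.
move=> t1; apply: hull_conj_of => //; set s := t ^ y.
have s1 : 1 ≺ s by rewrite -(conj1g y) olt_conj.
have [[k sk]|nk] := pselect (exists k, s ≼ t ^+ k).
  by apply: hull_pos sk => //; exact: oltW.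
have ts k : t ^+ k ≼ s by apply/negP => ?; apply: nk; exists k; exact: oltW.
have sst : hull s t.
  by apply: (@hull_pos _ _ _ _ _ 1%N) => //; [exact: oltW|have := ts 1%N; rewrite !expg1].
have := @holder_conj_gen s y^-1 s1; rewrite conjgK => /(_ sst) h.
have := @holder_ub _ _ o_bi R _ s1 2 1%R t sst isT.
rewrite h zexp1r => /(_ (ts 2)); lra.
Qed.

Lemma holder_conj t y z : 1 ≺ t -> hull t z -> holder t (z ^ y) = holder t z.
Proof.
move=> t1 tz; have ty := hull_conj y t1 (hull_gen o_bi t1).
rewrite -[RHS]mul1r -(holder_conj_gen t1 ty).
apply: (holder_uniq o_bi t1 (f := fun z => holder t (z ^ y))) => // {tz}z.
  by move=> u tz tu; rewrite conjMg (holderM o_bi) //; exact: hull_conj.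
move=> tz z1; apply: (holder_ge0 o_bi) (hull_conj _ t1 tz) _ => //.
by rewrite -(conj1g y) olt_conj.
Qed.

End ConjugationInvariance.

(** * Changing an order along a homomorphism *)

Section Reordering.
Variables (G : groupType) (o : left_order G).
Hypothesis o_bi : BiO G o.
Variable R : realType.
Implicit Types (x y z t : G) (n : nat) (p : int).

Local Notation "x ≺ y" := (o x y) (at level 70).
Local Notation "x ≼ y" := (~~ o y x) (at level 70).

Variables (D : set G) (f : G -> R).
Hypothesis D_sub : is_subgroup D.
Hypothesis DJ : forall x y, D x -> D (x ^ y).
Hypothesis D_convex : forall x y, D y -> 1 ≼ x -> x ≼ y -> D x.
Hypothesis fM : forall x y, D x -> D y -> f (x * y) = (f x + f y)%R.
Hypothesis fJ : forall x y, D x -> f (x ^ y) = f x.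

(** Inside the convex normal subgroup [D] the sign of [f] decides, the old order
    breaking ties; outside [D] nothing changes. Convexity of [D] makes the part
    outside absorb [D], and conjugation invariance makes the cone normal. *)
Definition reordered_cone : set G := [set x |
  (~ D x /\ 1 ≺ x) \/ (D x /\ ((0 < f x)%R \/ (f x = 0%R /\ 1 ≺ x)))].

Let P := reordered_cone.

Let DM := subgroupM D_sub.
Let DV := subgroupV D_sub.

Let D_mul_olt x y : ~ D x -> 1 ≺ x -> D y -> 1 ≺ x * y.
Proof.
move=> nDx x1 Dy; rewrite -(olt_mul2r o_bi y^-1) mul1g mulgK.
have [//|/negP xy] := boolP (y^-1 ≺ x); case: nDx; apply: (D_convex (DV Dy)).
  exact: oltW.
exact/negP.
Qed.

Let DMl x y : ~ D x -> D y -> ~ D (x * y).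
Proof. by move=> nDx Dy Dxy; apply: nDx; rewrite -(mulgK y x); exact: DM (DV _). Qed.

Let DMr x y : D x -> ~ D y -> ~ D (x * y).
Proof. by move=> Dx nDy Dxy; apply: nDy; rewrite -(mulKg x y); exact: DM (DV _) _. Qed.

Let PM x y : P x -> P y -> P (x * y).
Proof.
move=> [[nDx x1]|[Dx fx]] [[nDy y1]|[Dy fy]].
- left; have x_xy : x ≺ x * y by rewrite -[X in X ≺ _]mulg1 olt_mul2l.
  split; last exact: lo_trans x_xy.
  by move=> Dxy; apply: nDx; apply: (D_convex Dxy); apply: oltW.
- by left; split; [exact: DMl | exact: D_mul_olt].
- left; split; first exact: DMr.
  by rewrite -(olt_conj o_bi x) conj1g /conjg mulgA mulKg D_mul_olt.
right; split; first exact: DM.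
rewrite fM //; case: fx fy => [fx|[fx x1]] [fy|[fy y1]].
- by left; exact: addr_gt0.
- by left; rewrite fy addr0.
- by left; rewrite fx add0r.
- right; rewrite fx fy addr0; split=> //.
  by apply: (lo_trans x1); rewrite -[X in X ≺ _]mulg1 olt_mul2l.
Qed.

Let f1 : f 1 = 0%R. Proof. exact (hom_on1 D_sub fM). Qed.
Let fV x : D x -> f x^-1 = (- f x)%R. Proof. exact (hom_onV D_sub fM (x:=x)). Qed.

Let PV x : P x \/ x = 1 \/ P x^-1.
Proof.
have V1 : (1 ≺ x) \/ x = 1 \/ (1 ≺ x^-1).
  by rewrite olt_1inv //; have /or3P[->|/eqP->|->] := lo_total o 1 x; auto.
have [Dx|nDx] := pselect (D x); last first.
  case: V1 => [x1|[->|x1]]; [by left; left|by right; left|].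
  by right; right; left; split => // /DV; rewrite invgK.
have DVx := DV Dx; have [fx|fx|fx] := ltgtP (f x) 0%R.
- by right; right; right; split=> //; left; rewrite fV // oppr_gt0.
- by left; right; split=> //; left.
case: V1 => [x1|[->|x1]]; [|by right; left|].
  by left; right; split=> //; right.
by right; right; right; split=> //; right; rewrite fV // fx oppr0.
Qed.

Let P1 : ~ P 1.
Proof.
case=> [[_]|[D1]]; first by rewrite lo_irr.
by rewrite f1 // ltxx lo_irr => -[|[_]].
Qed.

Let PJ x y : P x -> P (x ^ y).
Proof.
have x1J : 1 ≺ x -> 1 ≺ x ^ y by rewrite -{2}(conj1g y) olt_conj.
move=> [[nDx x1]|[Dx fx]]; [left|right].
  split; last exact: x1J.
  by move=> /(@DJ _ y^-1); rewrite conjgK.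
split; first exact: DJ.
by rewrite fJ //; case: fx => [|[]]; [left|right; auto].
Qed.

Let r : rel G := fun x y => `[< P (x^-1 * y) >].

Let r_irr : irreflexive r.
Proof. by move=> x; apply/asboolP; rewrite mulVg. Qed.

Let r_trans : transitive r.
Proof.
move=> y x z /asboolP xy /asboolP yz; apply/asboolP.
by have := PM xy yz; rewrite mulgA mulgK.
Qed.

Let r_total x y : [|| r x y, x == y | r y x].
Proof.
have [h|[h|h]] := PV (x^-1 * y); apply/or3P.
- by apply: Or31; apply/asboolP.
- by apply: Or32; apply/eqP; rewrite -[LHS]mulg1 -h mulVKg.
- by apply: Or33; apply/asboolP; rewrite invgM invgK in h.
Qed.

Let r_left g x y : r x y -> r (g * x) (g * y).
Proof. by rewrite /r invgM -mulgA mulKg. Qed.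

Definition reordering : left_order G := LeftOrder r_irr r_trans r_total r_left.

Lemma reordering_gt1 x : reordering 1 x <-> reordered_cone x.
Proof. by rewrite /= /r invg1 mul1g; split=> /asboolP. Qed.

Lemma reordering_BiO : BiO G reordering.
Proof.
move=> g x y /asboolP/(@PJ _ g) h; apply/asboolP.
by rewrite invgM -mulgA [x^-1 * _]mulgA.
Qed.

End Reordering.

(** * Consequences of isolation *)

Definition isolating (G : groupType) (o : left_order G) (gs : seq G) : Prop :=
  (forall g, g \in gs -> o 1 g) /\
  forall o' : left_order G, BiO G o' -> (forall g, g \in gs -> o' 1 g) -> o' = o.

(** A neighbourhood of [o] contains a finite intersection of subbasic sets
    [x ≺ y], and by left invariance each of these says that [x^-1 y] is
    positive. *)
Lemma isolatedP (G : groupType) (o : set_type (BiO G)) :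
  isolated [set: set_type (BiO G)] o -> exists gs, isolating (set_val o) gs.
Proof.
case=> _ [V [_ [[U [E EU UE] <-] Uo UV] Vo]].
move: Uo; rewrite /preimage /= -UE => -[W EW Wo].
have [F FS FW] := EU _ EW.
have /choice[h hE] : forall A : set (left_order G), exists p : G * G,
    A \in F -> A = [set o' : left_order G | o' p.1 p.2].
  move=> A; have [/FS/set_mem[x [y Axy]]|nFA] := boolP (A \in F).
    by exists (x, y).
  by exists (1, 1) => AF; case/negP: nFA.
exists [seq (h A).1^-1 * (h A).2 | A <- enum_fset F]; split.
  move=> _ /mapP[A AF ->]; rewrite olt_divl.
  by move: Wo; rewrite -FW => /(_ _ AF) /=; rewrite {1}(hE _ AF).
move=> o' o'_bi o'_gt1.
have Vo' : V (exist _ o' (mem_set o'_bi)).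
  apply: UV; rewrite /preimage /= -UE; exists W => //.
  suff: (W : set (left_order G)) o' by [].
  rewrite -FW => A AF /=; rewrite (hE _ AF) /= -olt_divl.
  by apply: o'_gt1; apply/mapP; exists A.
have : (V `&` [set: BiO G]) (exist _ o' (mem_set o'_bi)) by [].
by rewrite Vo => /= <-.
Qed.

Section IsolatedOrder.
Variables (G : groupType) (o : left_order G) (gs : seq G).
Hypothesis o_bi : BiO G o.
Hypothesis o_iso : isolating o gs.
Variable R : realType.
Implicit Types (x y z t : G) (n : nat) (p : int).

Local Notation "x ≺ y" := (o x y) (at level 70).
Local Notation "x ≼ y" := (~~ o y x) (at level 70).
Local Notation hull := (hull o).
Local Notation holder := (holder o R).

(** Otherwise reordering [D] along [f] keeps [gs] positive and makes some positive
    [x] negative. *)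
Lemma isolated_hom_ge0 (D : set G) (f : G -> R) :
    is_subgroup D -> (forall x y, D x -> D (x ^ y)) ->
    (forall x y, D y -> 1 ≼ x -> x ≼ y -> D x) ->
    (forall x y, D x -> D y -> f (x * y) = (f x + f y)%R) ->
    (forall x y, D x -> f (x ^ y) = f x) ->
    (forall g, g \in gs -> D g -> (0 <= f g)%R) ->
  forall x, D x -> 1 ≺ x -> (0 <= f x)%R.
Proof.
move=> D_sub DJ Dc fM fJ f_ge0 x Dx x1; rewrite leNgt; apply/negP => fx.
have [gs1 uniq_o] := o_iso.
pose o' := reordering o_bi D_sub Dc fM.
have oo' : o' = o.
  apply: uniq_o; first exact: (reordering_BiO DJ fJ).
  move=> g gg; apply/reordering_gt1.
  have [Dg|nDg] := pselect (D g); [right|left]; split=> //; last exact: gs1.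
  have := f_ge0 g gg Dg; rewrite le_eqVlt => /orP[/eqP <-|]; [right|left] => //.
  by split=> //; exact: gs1.
have : o' 1 x^-1.
  apply/reordering_gt1; right; split; [exact (subgroupV D_sub Dx) | left].
  by rewrite (hom_onV D_sub fM) // oppr_gt0.
by rewrite oo' olt_1inv // => /(lo_trans x1); rewrite lo_irr.
Qed.

Hypothesis G_nil : locally_nilpotent G.

(** Reversing the archimedean layer of [t], that is reordering [hull t] along
    [- holder t], must disturb some element of [gs]; such an element belongs to
    that very layer. *)
Lemma isolating_archimedean t : 1 ≺ t ->
  exists g, [/\ g \in gs, hull t g & hull g t].
Proof.
move=> t1; apply: contrapT => no_g.
suff : (0 <= - holder t t)%R by rewrite holder_gen //; lra.
apply: (@isolated_hom_ge0 (hull t) (fun x => - holder t x)%R) => //.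
- exact: hull_subgroup.
- by move=> x y; exact: hull_conj.
- by move=> x y; exact: hull_convex.
- by move=> x y tx ty; rewrite holderM // opprD.
- by move=> x y tx; rewrite holder_conj.
- move=> g gg tg; rewrite oppr_ge0 leNgt; apply/negP => hg; apply: no_g.
  exists g; split=> //; have g1 := (o_iso.1 g gg).
  pose n := Num.bound (holder t g)^-1%R.
  apply: (@hull_pos _ _ o_bi _ _ n) => //; first exact: oltW.
  apply/negP => gt.
  have n_gt : ((holder t g)^-1 < n%:R)%R by apply: archi_boundP; rewrite invr_ge0 ltW.
  have n0 : (0 < n)%N by rewrite -(ltr0n R) (lt_trans _ n_gt) // invr_gt0.
  have := @holder_ub _ _ o_bi R _ t1 n 1%R g tg n0; rewrite zexp1r oltW // => /(_ isT).
  rewrite ler_pdivlMr ?ltr0n // leNgt => /negP; apply.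
  by rewrite -ltr_pdivrMl // mulr1.
- exact: hull_gen.
Qed.

End IsolatedOrder.

(** * Real numbers as a rational vector space *)

Section IrrationalFunctional.
Local Open Scope ring_scope.

(** Take by Zorn's lemma a rational subspace [H] maximal among those missing the
    coset of [a] modulo the rationals. Maximality puts 1 in [H] and makes the
    line spanned by [a] a complement of [H]; the functional is the coordinate
    along that line. *)
Lemma irrational_functional (R : realType) (a : R) :
    (forall q : rat, a <> ratr q) ->
  exists f : R -> R, [/\ {morph f : x y / x + y}, f 1 = 0 & f a = 1].
Proof.
move=> a_irr.
pose P (A : set R) := [/\ forall x y, A x -> A y -> A (x - y),
  forall (q : rat) x, A x -> A (ratr q * x) &
  forall (q : rat) x, A x -> x <> a + ratr q].
have [|H [[HB HZ Ha] Hmax]] := @Zorn_bigcup _ P.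
  move=> F FP F_tot; split.
  - move=> x y [X FX Xx] [Y FY Yy].
    have [XY|YX] := F_tot _ _ FX FY; [exists Y => // | exists X => //].
      by have [YB _ _] := FP _ FY; apply: YB => //; exact: XY.
    by have [XB _ _] := FP _ FX; apply: XB => //; exact: YX.
  - move=> q x [X FX Xx]; exists X => //.
    by have [_ XZ _] := FP _ FX; exact: XZ.
  - by move=> q x [X FX Xx]; have [_ _] := FP _ FX; apply.
(* The empty set, as the union of the empty chain, satisfies [P]; so that [H] is
   nonempty has to come from maximality. *)
have H0 : H 0.
  apply: contrapT => nH0; apply: (Hmax [set 0]); last first.
    split=> [x y -> ->|q x ->|q x -> /eqP].
    - by rewrite /= subr0.
    - by rewrite /= mulr0.
    - rewrite eq_sym addr_eq0 => /eqP aq; apply: (a_irr (- q)).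
      by rewrite rmorphN.
  split=> [x Hx|/(_ 0)]; last by move=> /(_ erefl).
  by case: nH0; rewrite -(subrr x); exact: HB.
have HD x y : H x -> H y -> H (x + y).
  by move=> Hx Hy; rewrite -[y]opprK; apply: (HB) => //; rewrite -sub0r; exact: HB.
have H_max x : ~ H x -> exists q r h, H h /\ h + ratr q * x = a + ratr r.
  move=> nHx; apply: contrapT => no_qrh.
  apply: (Hmax [set u | exists h q, H h /\ u = h + ratr q * x]).
    split=> [h Hh|/(_ x) BH].
      by exists h, 0; rewrite rmorph0 mul0r addr0.
    by apply/nHx/BH; exists 0, 1; rewrite rmorph1 mul1r add0r.
  split.
  - move=> _ _ [h [q [Hh ->]]] [k [r [Hk ->]]]; exists (h - k), (q - r).
    by split; [exact: HB | rewrite rmorphB /=; lra].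
  - move=> r _ [h [q [Hh ->]]]; exists (ratr r * h), (r * q).
    by split; [exact: HZ | rewrite rmorphM /=; lra].
  - by move=> r _ [h [q [Hh ->]]] e; apply: no_qrh; exists q, r, h.
have H1 : H 1.
  apply: contrapT => /H_max[q [r [h [Hh e]]]]; apply: (Ha (r - q) _ Hh).
  by rewrite rmorphB /=; lra.
have ex_c x : exists c : rat, H (x - ratr c * a).
  have [Hx|/H_max[q [r [h [Hh e]]]]] := pselect (H x).
    by exists 0; rewrite rmorph0 mul0r subr0.
  have q0 : q != 0.
    apply/eqP => q0; apply: (Ha r _ Hh).
    by move: e; rewrite q0 rmorph0 mul0r addr0.
  exists q^-1; have -> : x - ratr q^-1 * a = ratr q^-1 * (ratr r * 1 - h).
    have e' : ratr q * x = a + ratr r - h by lra.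
    have -> : x = ratr q^-1 * (a + ratr r - h).
      by rewrite -e' mulrA -rmorphM mulVf // rmorph1 mul1r.
    by rewrite mulr1; lra.
  by apply: (HZ); apply: HB => //; exact: HZ.
have uniq_c c : H (ratr c * a) -> c = 0.
  move=> Hc; apply: contrapT => /eqP c0; have := HZ c^-1 _ Hc.
  by rewrite mulrA -rmorphM mulVf // rmorph1 mul1r => /(Ha 0); apply; rewrite rmorph0 addr0.
have /choice[c cE] := ex_c; exists (fun x => ratr (c x)); split.
- move=> x y; rewrite -rmorphD; congr ratr; apply/eqP; rewrite eq_sym -subr_eq0.
  apply/eqP/uniq_c; rewrite rmorphB rmorphD /=.
  have := HB _ _ (cE (x + y)) (HD _ _ (cE x) (cE y)).
  by congr H; lra.
- rewrite (uniq_c (c 1)) ?rmorph0 //.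
  by have := HB _ _ H1 (cE 1); congr H; lra.
- have -> : c a = 1; last by rewrite rmorph1.
  apply/eqP; rewrite eq_sym -subr_eq0; apply/eqP/uniq_c.
  by have := cE a; congr H; rewrite rmorphB rmorph1 /=; lra.
Qed.

Lemma small_perturbation (R : realFieldType) (I : eqType) (s : seq I) (u v : I -> R) :
    (forall i, i \in s -> 0 <= u i) -> (forall i, i \in s -> u i = 0 -> 0 <= v i) ->
  exists2 e, 0 < e & forall i, i \in s -> 0 <= u i + e * v i.
Proof.
elim: s => [|i s IHs] u0 v0; first by exists 1.
have [j sj||e e0 he] := IHs.
- by apply: u0; rewrite inE sj orbT.
- by move=> j sj; apply: v0; rewrite inE sj orbT.
have [d d0 hd] : exists2 d, 0 < d & 0 <= u i + d * v i.
  have := u0 i (mem_head _ _); rewrite le_eqVlt => /orP[/eqP ui|ui].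
    exists 1; rewrite // -ui add0r mul1r.
    by apply: v0; rewrite ?mem_head.
  have w0 : 0 < `|v i| + 1 by rewrite ltr_wpDl.
  exists (u i / (`|v i| + 1)); first exact: divr_gt0.
  have -> : u i + u i / (`|v i| + 1) * v i = u i / (`|v i| + 1) * (`|v i| + 1 + v i).
    by rewrite mulrDr divfK // gt_eqF.
  apply: mulr_ge0; first by rewrite ltW // divr_gt0.
  have := ler_norm (- v i); rewrite normrN; lra.
have shrink a b w z : 0 < a -> a <= b -> 0 <= w -> 0 <= w + b * z -> 0 <= w + a * z :> R.
  move=> a0 ab w0 bz; have [z0|z0] := leP 0 z; first by rewrite addr_ge0 // mulr_ge0 // ltW.
  have := ler_wnM2r (ltW z0) ab; lra.
exists (Num.min d e); first by rewrite lt_min d0.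
move=> j sj; have uj := u0 _ sj; move: sj uj; rewrite inE => /orP[/eqP->|sj] uj.
  by apply: shrink hd => //; rewrite ?lt_min ?d0 ?ge_min ?lexx.
by apply: shrink (he _ sj) => //; rewrite ?lt_min ?d0 // ge_min lexx orbT.
Qed.

End IrrationalFunctional.

(** * The two top archimedean layers *)

Section TopHomomorphism.
Variables (G : groupType) (o : left_order G) (gs : seq G).
Hypothesis o_bi : BiO G o.
Hypothesis o_iso : isolating o gs.
Variable R : realType.
Implicit Types (x y z t : G) (n : nat) (p : int).

Local Notation "x ≺ y" := (o x y) (at level 70).
Local Notation "x ≼ y" := (~~ o y x) (at level 70).
Local Notation hull := (hull o).
Local Notation holder := (holder o R).

(** For small [e > 0] the homomorphism [k := f + e g] is still nonnegative on [gs],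
    so it is nonnegative on all positive elements. But [f] and [g] are not
    proportional on the subgroup generated by [a] and [b], so some [a^p b^-m] has
    [f > 0] and [k < 0]. *)
Lemma isolating_no_transverse_hom (f g : G -> R) a b :
    (forall x y, f (x * y) = (f x + f y)%R) ->
    (forall x y, g (x * y) = (g x + g y)%R) ->
    (forall x, 1 ≼ x -> (0 <= f x)%R) ->
    (forall x, x \in gs -> f x = 0%R -> (0 <= g x)%R) ->
  f a = 1%R -> g a = 0%R -> g b = 1%R -> False.
Proof.
move=> fM gM f_ge0 g_ge0 fa ga gb.
have [||e e0 he] := @small_perturbation R _ gs f g.
- by move=> x gx; apply/f_ge0/oltW => //; exact: o_iso.1.
- exact: g_ge0.
pose k x := (f x + e * g x)%R.
have kM x y : k (x * y) = (k x + k y)%R by rewrite /k fM gM; lra.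
have T := setT_subgroup G.
have kM' x y : [set: G] x -> [set: G] y -> k (x * y) = (k x + k y)%R by [].
have fM' x y : [set: G] x -> [set: G] y -> f (x * y) = (f x + f y)%R by [].
have gM' x y : [set: G] x -> [set: G] y -> g (x * y) = (g x + g y)%R by [].
(* [f] takes at [a^p b^-m] a value in ]0, 1], and [g] the value [-m] with
   [e m > 1]. *)
pose m := Num.bound e^-1%R; pose p := (Num.floor (f b * m%:R) + 1)%R.
have em : (1 < e * m%:R)%R.
  rewrite -ltr_pdivrMl // mulr1; apply: archi_boundP.
  by rewrite invr_ge0 ltW.
have /andP[p_le p_gt] : (p%:~R - 1 <= f b * m%:R < p%:~R)%R.
  by have := floor_itv (f b * m%:R)%R; rewrite /p !intrD addrK.
pose x := zexp a p * b ^- m.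
have fx : f x = (p%:~R - f b * m%:R)%R.
  rewrite fM (hom_onV T fM') // (hom_onX T fM') // (hom_on_zexp T fM') // fa.
  by rewrite mulr_natr.
have gx : g x = (- m%:R)%R.
  rewrite gM (hom_onV T gM') // (hom_onX T gM') // (hom_on_zexp T gM') // ga gb.
  by rewrite mul0rz add0r.
have x1 : 1 ≺ x.
  have [//|x1] := boolP (1 ≺ x).
  have : (0 <= f (x^-1)%g)%R.
    by apply: f_ge0; rewrite -(olt_inv o_bi) invgK invg1.
  rewrite (hom_onV T fM') // fx; lra.
have : (0 <= k x)%R.
  apply: (isolated_hom_ge0 o_bi o_iso (D := setT) (f := k)) => //.
    by move=> u v _; rewrite /conjg !kM (hom_onV T kM') //; lra.
  by move=> u gu _; exact: he.
rewrite /k fx gx; lra.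
Qed.

Hypothesis G_nil : locally_nilpotent G.
Variable a : G.
Hypothesis a1 : 1 ≺ a.
Hypothesis a_top : forall x, hull a x.

(** An irrational value gives a functional on the reals that is independent of the
    identity; composing it with [holder a] yields a homomorphism that vanishes on
    the kernel of [holder a] and is transverse to [holder a]. *)
Lemma holder_rational x : exists q : rat, holder a x = ratr q.
Proof.
apply: contrapT => no_q.
have [|f [fD f1 fx]] := @irrational_functional R (holder a x).
  by move=> q e; apply: no_q; exists q.
apply: (@isolating_no_transverse_hom (holder a) (f \o holder a) a x) => //=.
- by move=> y z; rewrite holderM.
- by move=> y z; rewrite holderM // fD.
- by move=> y y1; exact: holder_ge0.
- by move=> y _ ->; have := fD 0%R 0%R; rewrite addr0; lra.
- by rewrite holder_gen.
- by rewrite holder_gen.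
Qed.

(** Here the kernel of [holder a] is nontrivial, generated as a convex subgroup by
    [h], and [holder a] has rational values. Then [x^n a^-p] lies in the kernel as
    soon as [holder a x = p / n], and [holder h] extends to the whole group by
    sending [x] to [holder h (x^n a^-p) / n], although the group need not be
    abelian. *)
Section Kernel.
Variable h : G.
Hypothesis h1 : 1 ≺ h.
Hypothesis h_top : forall x, hull h x <-> holder a x = 0%R.

Let u x n p : R := holder h (x ^+ n * zexp a (- p)%R).
Let rep x n p := (holder a x * n%:R = p%:~R)%R.

Let rep_hull x n p : rep x n p -> hull h (x ^+ n * zexp a (- p)%R).
Proof.
have D := hull_subgroup o_bi a; have hM := holderM o_bi R a1.
move=> e; apply/h_top; rewrite hM // (hom_onX D hM) // (hom_on_zexp D hM) //.
by rewrite -[(_ *+ n)%R]mulr_natr e holder_gen // intrN subrr.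
Qed.

Let holder_twist x y p q : hull h (x * zexp a (- p)%R) -> hull h (y * zexp a (- q)%R) ->
  hull h (x * y * zexp a (- (p + q))%R) /\
  holder h (x * y * zexp a (- (p + q))%R) =
    (holder h (x * zexp a (- p)%R) + holder h (y * zexp a (- q)%R))%R.
Proof.
set v := y * _ => hx hy.
have -> : x * y * zexp a (- (p + q))%R =
    x * zexp a (- p)%R * (v ^ zexp a (- p)%R).
  by rewrite opprD addrC zexpD /conjg /v !mulgA mulgK.
have hvJ := hull_conj o_bi G_nil R (zexp a (- p)%R) h1 hy.
split; first exact: hullM.
by rewrite holderM // holder_conj.
Qed.

Let u_scale x n p k : rep x n p -> u x (n * k) (p * k%:Z)%R = (k%:R * u x n p)%R.
Proof.
move=> xnp; suff : hull h (x ^+ (n * k)%N * zexp a (- (p * k%:Z))%R) /\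
  u x (n * k) (p * k%:Z)%R = (k%:R * u x n p)%R by case.
elim: k => [|k [IH1 IH2]].
  rewrite /u muln0 mulr0 oppr0 mul0r mulg1.
  by split; [exact: hull1 | exact: (hom_on1 (hull_subgroup o_bi h) (holderM o_bi R h1))].
have [] := holder_twist (rep_hull xnp) IH1.
rewrite -expgnDr -mulnS /u.
have -> : (p * k.+1%:Z = p + p * k%:Z)%R by lia.
by rewrite [X in _ = (_ + X)%R]IH2 mulrS mulrDl mul1r.
Qed.

(** Again [(x y)^n] is squeezed between [x^n y^n] and [y^n x^n]; the values at both
    ends agree because [holder h] is invariant under conjugation by [a]. *)
Let u_mul x y n p q : rep x n p -> rep y n q ->
  u (x * y) n (p + q)%R = (u x n p + u y n q)%R.
Proof.
move=> xp yq.
have xyr : rep (x * y) n (p + q)%R.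
  by rewrite /rep holderM // mulrDl xp yq intrD.
have [hx hy] := (rep_hull xp, rep_hull yq).
have [xy1 xy2] := holder_twist hx hy.
have [yx1 yx2] := holder_twist hy hx.
have le_u v w : v ≼ w -> v * zexp a (- (p + q))%R ≼ w * zexp a (- (p + q))%R.
  by rewrite olt_mul2r.
rewrite [(q + p)%R]addrC in yx1 yx2.
apply/eqP; rewrite eq_le; apply/andP; split.
  have [[/le_u h2 /le_u h3]|[/le_u h2 /le_u h3]] := expgM_between o_bi x y n.
    rewrite /u [leRHS]addrC -yx2; apply: holder_le => //; exact: rep_hull.
  rewrite /u -xy2; apply: holder_le => //; exact: rep_hull.
have [[/le_u h2 /le_u h3]|[/le_u h2 /le_u h3]] := expgM_between o_bi x y n.
  rewrite /u -xy2; apply: holder_le => //; exact: rep_hull.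
rewrite /u [leLHS]addrC -yx2; apply: holder_le => //; exact: rep_hull.
Qed.

Lemma extend_kernel_hom : exists g : G -> R,
  [/\ forall x y, g (x * y) = (g x + g y)%R, g a = 0%R &
      forall x, hull h x -> g x = holder h x].
Proof.
have ex_rep x : exists np : nat * int, (0 < np.1)%N /\ rep x np.1 np.2.
  have [q xq] := holder_rational x.
  exists (`|denq q|%N, numq q); split; first by rewrite absz_gt0 denq_neq0.
  rewrite /rep xq /= /ratr pmulrn absz_denq mulfVK //.
  by rewrite intr_eq0 denq_neq0.
have /choice[c cP] := ex_rep.
pose g x := (u x (c x).1 (c x).2 / (c x).1%:R)%R.
have gE x n p : (0 < n)%N -> rep x n p -> (g x * n%:R)%R = u x n p.
  move=> n0 xnp; have [m0 xmq] := cP x; rewrite /g.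
  move: (c x) m0 xmq => [m q] /= m0 xmq.
  have mR : (m%:R != 0 :> R)%R by rewrite pnatr_eq0 -lt0n.
  have pq : (p * m%:Z = q * n%:Z)%R.
    apply: (@intr_inj R); rewrite !intrM -xnp -xmq -!pmulrn; lra.
  apply: (mulfI mR); rewrite -(u_scale _ xnp) pq mulnC (u_scale _ xmq).
  by rewrite mulrAC mulrCA divff // mulr1 mulrC.
exists g; split.
- move=> x y; have [n0 xr] := cP x; have [m0 yr] := cP y.
  move: (c x) n0 xr (c y) m0 yr => [n p] /= n0 xr [m q] /= m0 yr.
  have nm0 : (0 < n * m)%N by rewrite muln_gt0 n0.
  have xr' : rep x (n * m) (p * m%:Z)%R.
    by rewrite /rep natrM mulrA xr intrM.
  have yr' : rep y (n * m) (q * n%:Z)%R.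
    by rewrite /rep natrM [(n%:R * _)%R]mulrC mulrA yr intrM.
  have xyr : rep (x * y) (n * m) (p * m%:Z + q * n%:Z)%R.
    by rewrite /rep holderM // mulrDl xr' yr' intrD.
  have nmR : ((n * m)%:R != 0 :> R)%R by rewrite pnatr_eq0 -lt0n.
  by apply: (mulIf nmR); rewrite mulrDl !(gE _ _ _ nm0 xr', gE _ _ _ nm0 yr', gE _ _ _ nm0 xyr) u_mul.
- have ar : rep a 1 1%R by rewrite /rep holder_gen // mul1r.
  have := gE a 1%N 1%R isT ar; rewrite mulr1 => ->.
  rewrite /u zexpN zexp1r mulgV.
  exact: (hom_on1 (hull_subgroup o_bi h) (holderM o_bi R h1)).
- move=> x hx; have xr : rep x 1 0%R by rewrite /rep (h_top x).1 // mul0r.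
  by have := gE x 1%N 0%R isT xr; rewrite mulr1 => ->; rewrite /u oppr0 mulg1.
Qed.

Lemma holder_kernel_trivial : False.
Proof.
have [g [gM ga gh]] := extend_kernel_hom.
apply: (@isolating_no_transverse_hom (holder a) g a h) => //.
- by move=> x y; rewrite holderM.
- by move=> x x1; exact: holder_ge0.
- move=> x gx x0; have hx : hull h x by apply/h_top.
  by rewrite gh //; apply: holder_ge0 => //; apply/oltW => //; exact: o_iso.1.
- exact: holder_gen.
- by rewrite gh ?holder_gen //; exact: hull_gen.
Qed.

End Kernel.
End TopHomomorphism.

(** * Groups of rank at most one *)

Lemma trivial_rank_le (G : groupType) n : (forall x : G, x = 1) -> rank_le G n.
Proof.
move=> G1; exists 0%N => //; exists (fun=> 0%R) => v.
have tens0 x q : tens x q = 0%R :> tensq G.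
  by apply: (addrI (tens x q)); rewrite -tens_mull (G1 x) mulg1 addr0.
have v0 : v = 0%R.
  by have [s ->] := tensq_sum v; apply: big1 => z _; exact: tens0.
exists [ffun=> 0%R]; split; first by rewrite big_ord0.
by move=> c _; apply/ffunP => -[].
Qed.

(** The hypotheses embed [G] into the rationals by [f]. If [f x] has numerator [p]
    and denominator [d] then [x^d = a^p], so [a] spans the tensor product with
    the rationals; the extension of [f] to that product shows that [a] is not
    zero there. *)
Lemma rational_rank_le1 (G : groupType) (R : realType) (f : G -> R) (a : G) :
    (forall x y, f (x * y) = (f x + f y)%R) -> (forall x, f x = 0%R -> x = 1) ->
    (forall x, exists q : rat, f x = ratr q) -> f a = 1%R ->
  abelian_group G /\ rank_le G 1.
Proof.
move=> fM f_inj f_rat fa; have T := setT_subgroup G.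
have fM' x y : [set: G] x -> [set: G] y -> f (x * y) = (f x + f y)%R by [].
have f_eq x y : f x = f y -> x = y.
  move=> xy; apply: divg1_eq; apply: f_inj.
  by rewrite fM (hom_onV T fM') // xy subrr.
split; first by move=> x y; apply: f_eq; rewrite !fM addrC.
have tens_hom (q : rat) x y : [set: G] x -> [set: G] y ->
  tens (x * y) q = (tens x q + tens y q)%R by move=> _ _; exact: tens_mull.
exists 1%N => //; exists (fun=> tens a 1%R) => v.
have /choice[r rE] := f_rat.
have tens_a x q : tens x q = ((r x * q) *: tens a 1)%R.
  set d := denq (r x); have d0 : (d%:~R != 0 :> rat)%R by rewrite intr_eq0 denq_neq0.
  have xd : zexp x d = zexp a (numq (r x)).
    apply: f_eq; rewrite !(hom_on_zexp T fM') // fa rE -mulrzr.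
    have -> : (d%:~R = ratr d%:~R :> R)%R by rewrite ratr_int.
    by rewrite -rmorphM /d -numqE rmorph_int.
  have tens_z (y : G) p s : tens (zexp y p) s = (p%:~R *: tens y s)%R.
    by rewrite scaler_int; exact: (hom_on_zexp (f := fun x => tens x s) T (tens_hom s) p I).
  apply: (scalerI d0); rewrite -tens_z xd tens_z scalerA mulrA [(d%:~R * _)%R]mulrC.
  by rewrite /d -numqE tens_scale -scalerA tens_scale mulr1 tens_scale.
have [s vE] := tensq_sum v.
have [c vc] : exists c, v = (c *: tens a 1)%R.
  exists (\sum_(z <- s) r z.1 * z.2)%R.
  by rewrite vE scaler_suml; apply: eq_bigr => z _.
exists [ffun=> c]; split; first by rewrite big_ord1 ffunE.
move=> c'; rewrite big_ord1 vc => cc'.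
have [x y q|x p q|k [kE _]] := @tensq_universal G R (fun x q => f x * ratr q)%R.
- by rewrite fM mulrDl.
- by rewrite rmorphD mulrDr.
apply/ffunP => i; rewrite ffunE !ord1.
have := congr1 k cc'; rewrite !tens_scale !kE fa !mul1r !mulr1.
exact: fmorph_inj.
Qed.

(** * Isolated orders force rank at most one *)

Lemma seq_max (G : groupType) (o : left_order G) (P : G -> Prop) (s : seq G) x :
    x \in s -> P x ->
  exists y, [/\ y \in s, P y & forall z, z \in s -> P z -> ~~ o y z].
Proof.
elim: s x => // w s IHs x xs Px.
have [[v [vs Pv]]|no_v] := pselect (exists v, v \in s /\ P v); last first.
  have xw : x = w.
    by move: xs; rewrite inE => /orP[/eqP//|xs]; case: no_v; exists x.
  exists w; rewrite mem_head -xw; split => // z.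
  rewrite inE xw => /orP[/eqP->|zs Pz]; first by rewrite lo_irr.
  by case: no_v; exists z.
have [y [ys Py y_max]] := IHs v vs Pv.
have [[Pw yw]|nw] := pselect (P w /\ o y w).
  exists w; rewrite mem_head; split => // z.
  rewrite inE => /orP[/eqP->|zs Pz]; first by rewrite lo_irr.
  by apply/negP => /(lo_trans yw); apply/negP; exact: y_max.
exists y; rewrite inE ys orbT; split => // z.
rewrite inE => /orP[/eqP-> Pw|zs]; last exact: y_max.
by apply/negP => yw; apply: nw.
Qed.

(** Let [a] be the largest element of [gs], so that [holder a] is defined on all of
    [G]. If it had a nontrivial kernel, that kernel would be the convex hull of
    the largest element [h] of [gs] in it, which is impossible. *)
Lemma isolated_rank1 (G : groupType) (o : left_order G) (gs : seq G) :
    locally_nilpotent G -> BiO G o -> isolating o gs ->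
  abelian_group G /\ rank_le G 1.
Proof.
move=> G_nil o_bi o_iso; pose R : realType := Rdefinitions.R.
have [G1|] := pselect (forall x : G, x = 1).
  split; last exact: trivial_rank_le.
  by move=> x y; rewrite (G1 x) (G1 y).
move=> /existsNP[x0 /eqP x0_neq1].
have gt1 (P : G -> Prop) x : (P x -> P x^-1) -> P x -> x != 1 -> exists2 y, P y & o 1 y.
  move=> PV Px x1; have /or3P[?|/eqP ?|?] := lo_total o 1 x; first by exists x.
    by subst x; rewrite eqxx in x1.
  by exists x^-1; [exact: PV | rewrite olt_1inv].
have [t _ t1] := gt1 (fun=> True) x0 id I x0_neq1.
have arch := isolating_archimedean o_bi o_iso R G_nil.
have hull_top (Q : G -> Prop) h : (forall x, Q x -> Q x^-1) -> o 1 h ->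
    (forall g, g \in gs -> Q g -> ~~ o h g) ->
    (forall x y, Q x -> hull o x y -> Q y) ->
    forall x, Q x -> hull o h x.
  move=> QV h1 h_max Q_hull.
  have pos x : Q x -> o 1 x -> hull o h x.
    move=> Qx x1; have [g [gg xg [k [xk _]]]] := arch _ x1.
    apply: (@hull_pos _ _ o_bi _ _ k) => //; first exact: oltW.
    by apply: ole_trans xk _; apply: ole_exp => //; apply: h_max => //; exact: Q_hull xg.
  move=> x Qx; have /or3P[x1|/eqP<-|x1] := lo_total o 1 x; first exact: pos.
    exact: hull1.
  rewrite -[x]invgK; apply: hullV; apply: pos; first exact: QV.
  by rewrite olt_1inv.
have [g0 [g0s _ _]] := arch t t1.
have [a [ags _ a_max]] := @seq_max _ o (fun=> True) gs g0 g0s I.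
have a1 := o_iso.1 a ags.
have a_top x : hull o a x.
  by apply: (hull_top (fun=> True)) => // g gg _; exact: a_max.
have phiM x y : hull o a x -> hull o a y -> _ := @holderM _ _ o_bi R a a1 x y.
have A := hull_subgroup o_bi a.
pose K x := holder o R a x = 0%R.
have KV x : K x -> K x^-1 by rewrite /K (hom_onV A phiM) // => ->; rewrite oppr0.
have K_hull x y : K x -> hull o x y -> K y.
  move=> Kx [k [yk Yk]]; apply/eqP; rewrite eq_le -[X in _ && X]oppr_le0.
  rewrite -(hom_onV A phiM) //.
  have Kxk : holder o R a (x ^+ k) = 0%R by rewrite (hom_onX A phiM) // Kx mul0rn.
  by rewrite -Kxk !holder_le.
apply: (@rational_rank_le1 G R (holder o R a) a).
- by move=> x y; exact: phiM.
- move=> x Kx; apply: contrapT => /eqP x1.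
  have [y Ky y1] := gt1 K x (KV x) Kx x1.
  have [g1 [g1s yg1 _]] := arch y y1.
  have [h [hgs Kh h_max]] := @seq_max _ o K gs g1 g1s (K_hull _ _ Ky yg1).
  have h1 := o_iso.1 h hgs.
  have h_top z : hull o h z <-> K z by split; [exact: K_hull | exact: hull_top].
  exact: (holder_kernel_trivial o_bi o_iso G_nil a1 a_top h1 h_top).
- by move=> x; exact: (holder_rational o_bi o_iso).
- exact: holder_gen.
Qed.

Theorem proposition1p2 (G : groupType)
  (G_locnil : locally_nilpotent G)
  (G_rank : ~ (abelian_group G /\ rank_le G 1)) :
  isolated [set: set_type (BiO G)] = set0.
Proof.
rewrite predeqE => o; split => // /isolatedP[gs o_iso]; apply: G_rank.
by apply: isolated_rank1 o_iso => //; exact: set_mem (valP o).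
Qed.
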